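(* For each $n\in\{1,2,3,\dots\}\cup\{\infty\}$ there exists a locally finite group $G^n$ with a proper left invariant metric $d_n$ such that $\operatorname{asdim}_{AN}(G^n,d_n)=n$.
   Context: A group is locally finite if every finitely generated subgroup is finite. A metric $d$ on a group is proper left invariant if $d(gh,gk)=d(h,k)$ for all $g,h,k$ and every ball is finite. $\operatorname{asdim}_{AN}(X)$ is the least $n$ for which there are constants $C>0$, $k\in\mathbb{R}$ such that for every $s>0$ there is a cover $\{\mathcal U_0,\dots,\mathcal U_n\}$ of $X$ whose members have $s$-scale connected components (classes of ''joined by a finite chain inside the set with consecutive distances $<s$'') of diameter at most $Cs+k$; it is $\infty$ if no such $n$ exists. *)

(* Defs.v *)
From Stdlib Require Import Reals List.
Open Scope R_scope.

Record Group := {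
  carrier :> Type;
  gmul : carrier -> carrier -> carrier;
  gone : carrier;
  ginv : carrier -> carrier;
  gmul_assoc : forall a b c, gmul a (gmul b c) = gmul (gmul a b) c;
  gmul_one_l : forall a, gmul gone a = a;
  gmul_one_r : forall a, gmul a gone = a;
  gmul_inv_l : forall a, gmul (ginv a) a = gone;
  gmul_inv_r : forall a, gmul a (ginv a) = gone
}.

Definition finite_pred {X : Type} (P : X -> Prop) : Prop :=
  exists L : list X, forall x, P x -> In x L.

Inductive generated (G : Group) (S : list G) : G -> Prop :=
  | gen_base : forall x, In x S -> generated G S x
  | gen_one : generated G S (gone G)
  | gen_inv : forall x, generated G S x -> generated G S (ginv G x)
  | gen_mul : forall x y, generated G S x -> generated G S y ->
      generated G S (gmul G x y).

Definition locally_finite (G : Group) : Prop :=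
  forall S : list G, finite_pred (generated G S).

Definition is_metric {X : Type} (d : X -> X -> R) : Prop :=
  (forall x y, 0 <= d x y) /\
  (forall x y, d x y = 0 <-> x = y) /\
  (forall x y, d x y = d y x) /\
  (forall x y z, d x z <= d x y + d y z).

Definition proper_left_invariant_metric (G : Group) (d : G -> G -> R) : Prop :=
  is_metric d /\
  (forall g h k, d (gmul G g h) (gmul G g k) = d h k) /\
  (forall x (r : R), finite_pred (fun y => d x y <= r)).

Inductive s_chain {X : Type} (d : X -> X -> R) (U : X -> Prop) (s : R)
  : X -> X -> Prop :=
  | chain_refl : forall x, U x -> s_chain d U s x x
  | chain_step : forall x y z, U x -> d x y < s -> s_chain d U s y z ->
      s_chain d U s x z.

Definition asdimAN_le {X : Type} (d : X -> X -> R) (n : nat) : Prop :=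
  exists C k : R, 0 < C /\
    forall s : R, 0 < s ->
      exists U : nat -> X -> Prop,
        (forall x, exists i, (i <= n)%nat /\ U i x) /\
        (forall i, (i <= n)%nat -> forall x y,
           s_chain d (U i) s x y -> d x y <= C * s + k).

Inductive natinf := Fin (n : nat) | Inf.

Definition asdimAN_eq {X : Type} (d : X -> X -> R) (n : natinf) : Prop :=
  match n with
  | Fin m => asdimAN_le d m /\ (forall j, (j < m)%nat -> ~ asdimAN_le d j)
  | Inf => forall j, ~ asdimAN_le d j
  end.

(* Main.v *)
Require Import Defs.
From Stdlib Require Import Reals List Lia Lra ZArith.
From Stdlib Require Import Classical ClassicalEpsilon FunctionalExtensionality ProofIrrelevance.
From mathcomp Require all_boot zify.
Open Scope R_scope.

(** The group is the direct sum over the levels [i] of [(Z/2^i)^(dim i)] with the sup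
    metric in which a unit step at level [i] has length [2^(i^2)]; [dim i] is [n], or [i]
    when [n] is infinite. Since [2^(i^2)] is at least the diameter of all lower levels, at a given
    scale at most one level is neither invisible nor of comparable diameter.

    Upper bound: on that level, [n + 1] families of parallel walls of width the scale [t]
    and period a multiple of [t], shifted against each other by [t], cut each coordinate.
    A point lies in a wall of at most one family per coordinate, so it avoids all walls of
    some family, and short steps avoiding these walls stay in one cell.

    Lower bound: level [i] contains a scaled grid [{0,..,m}^(j+1)] with [m] unbounded. If it
    is covered by [j + 1] sets, some set joins two opposite faces by a chain of short steps,
    by the discrete Poincare-Miranda theorem. The latter is proved by applying Stokes'
    formula to the mod 2 cup product of the coboundaries of the given functions. *)

(** * The discrete Poincare-Miranda theorem *)

Module DiscretePoincareMiranda.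
Import all_boot zify.
Local Open Scope nat_scope.

Section Cochain.
Variable I : finType.

Definition shift (a : I) (x : I -> nat) : I -> nat := fun b => x b + (b == a).

Lemma shiftC a b x : shift a (shift b x) = shift b (shift a x).
Proof. by apply: functional_extensionality => c; rewrite /shift addnAC. Qed.

Variable f : I -> (I -> nat) -> bool.

(* The mod 2 cup product of the coboundaries of the [f c], [c] in [l], evaluated
   on the cube with lowest vertex [x] and edge directions [S]: it sums over all
   monotone edge paths, the k-th function being differentiated along the k-th edge. *)
Fixpoint cup (l : seq I) (S : {set I}) (x : I -> nat) : bool :=
  if l is c :: l' then
    \big[addb/false]_(a in S)
      ((f c (shift a x) (+) f c x) && cup l' (S :\ a) (shift a x))
  else true.

(** Each unordered pair occurs twice and cancels mod 2. The induction removes an element [c]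
    together with its row and its column, which are equal. *)
Lemma sum_symmetric_pairs (S : {set I}) (F : I -> I -> bool) :
  (forall a b, F a b = F b a) ->
  \big[addb/false]_(a in S) \big[addb/false]_(b in S :\ a) F a b = false.
Proof.
move: {2}#|S| (erefl #|S|) => k; elim: k S => [|k IH] S.
  by move/eqP; rewrite cards_eq0 => /eqP -> _; rewrite big_set0.
move=> cS symF; have /card_gt0P [c cinS] : 0 < #|S| by rewrite cS.
rewrite (big_setD1 c) //=.
have -> : \big[addb/false]_(a in S :\ c) \big[addb/false]_(b in S :\ a) F a b =
  \big[addb/false]_(a in S :\ c) (F c a (+) \big[addb/false]_(b in S :\ c :\ a) F a b).
  apply: eq_bigr => a; rewrite in_setD1 => /andP [ac aS].
  rewrite (big_setD1 c) /=; last by rewrite in_setD1 eq_sym ac.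
  rewrite symF; congr (_ (+) _); apply: eq_bigl => b.
  by rewrite !in_setD1; case: (b == c); case: (b == a).
rewrite big_split /= IH //; last by move: cS; rewrite (cardsD1 c) cinS => -[].
by rewrite addbF addbb.
Qed.

Lemma exchange_pairs (S : {set I}) (F : I -> I -> bool) :
  \big[addb/false]_(a in S) \big[addb/false]_(b in S :\ a) F a b =
  \big[addb/false]_(a in S) \big[addb/false]_(b in S :\ a) F b a.
Proof.
rewrite (exchange_big_dep (fun b => b \in S)) /=.
  apply: eq_bigr => b bS; apply: eq_bigl => a.
  by rewrite !in_setD1 bS andbT eq_sym andbC.
by move=> a b _; rewrite in_setD1 => /andP [].
Qed.

(** A cup product of coboundaries is a cocycle: the facets of a cube through its lowest vertex and
    the opposite ones give the same sum. Expanding the first coboundary on both sides yields four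
    double sums, two of which vanish by symmetry. *)
Lemma cup_closed l (S : {set I}) x :
  \big[addb/false]_(a in S) cup l (S :\ a) (shift a x) =
  \big[addb/false]_(a in S) cup l (S :\ a) x.
Proof.
elim: l S x => [|d l IH] S x //=; set g := f d.
have pull (h : I -> bool) (F : I -> I -> bool) :
  \big[addb/false]_(a in S) \big[addb/false]_(b in S :\ a) (h a && F a b) =
  \big[addb/false]_(a in S) (h a && \big[addb/false]_(b in S :\ a) F a b).
  by apply: eq_bigr => a _; rewrite big_distrr.
have expand (u v : I -> I -> bool) (F : I -> I -> bool) :
  \big[addb/false]_(a in S) \big[addb/false]_(b in S :\ a) ((u a b (+) v a b) && F a b) =
  \big[addb/false]_(a in S) \big[addb/false]_(b in S :\ a) (u a b && F a b) (+)
  \big[addb/false]_(a in S) \big[addb/false]_(b in S :\ a) (v a b && F a b).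
  rewrite -big_split /=; apply: eq_bigr => a _; rewrite -big_split /=.
  by apply: eq_bigr => b _; rewrite andb_addl.
rewrite !expand; set A := (X in X (+) _ = _); set B := (X in _ (+) X = _).
set A' := (X in _ = X (+) _); set B' := (X in _ = _ (+) X).
have setDD a b : S :\ a :\ b = S :\ b :\ a.
  by apply/setP => c; rewrite !in_setD1; case: (c == a); case: (c == b).
have -> : A = false.
  by apply: sum_symmetric_pairs => a b; rewrite shiftC setDD.
have -> : B' = false.
  transitivity (g x && \big[addb/false]_(a in S)
     \big[addb/false]_(b in S :\ a) cup l (S :\ a :\ b) (shift b x)).
    by rewrite big_distrr /=; apply: eq_bigr => a _; rewrite big_distrr.
  under eq_bigr => a _ do rewrite IH.
  by rewrite sum_symmetric_pairs ?andbF // => a b; rewrite setDD.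
(* In [B] the induction hypothesis moves the inner cup product to [shift a x]; exchanging [a] and
   [b] brings [A'] to the same form. *)
rewrite addFb addbF /B /A' pull [RHS]exchange_pairs pull.
apply: eq_bigr => a _; rewrite IH.
by under [in RHS]eq_bigr => b _ do rewrite setDD.
Qed.

(** All edges involved lie in the face where coordinate [b] equals [v]. There [f b] is constant, so
    its coboundary, one of the factors, vanishes. *)
Lemma cup_const (b : I) (v : nat) l (S : {set I}) x :
  (forall y z, y b = v -> z b = v -> f b y = f b z) ->
  b \in l -> b \notin S -> x b = v -> cup l S x = false.
Proof.
move=> fb; elim: l S x => [|c l IH] S x //= bl bS xb; rewrite big1 // => a aS.
have ab : (b == a) = false by apply: contraNF bS => /eqP ->.
have sb : shift a x b = v by rewrite /shift ab addn0.
move: bl; rewrite in_cons => /orP [/eqP <-|bl].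
  by rewrite (fb _ x) // addbb.
by rewrite IH ?andbF // in_setD1 ab.
Qed.

(** Some monotone path contributes, and [f c] changes value along one of its edges; the ends of that
    edge are [y] and [z]. *)
Lemma cup_nonzero l (S : {set I}) x c :
  cup l S x -> c \in l ->
  exists y z, [/\ forall b, x b <= y b <= x b + (b \in S),
    forall b, x b <= z b <= x b + (b \in S), f c y & ~~ f c z].
Proof.
elim: l S x => [|d l IH] S x //= nz cl.
have /existsP [a /and3P [aS fa rest]] :
  [exists a, [&& a \in S, f d (shift a x) (+) f d x & cup l (S :\ a) (shift a x)]].
  apply: contraT => /existsPn none; move: nz; rewrite big1 // => a aS.
  by apply/negP => h; move: (none a); rewrite aS h.
have box b : x b <= shift a x b <= x b + (b \in S).
  by rewrite /shift; case: eqP => [->|]; rewrite ?aS; lia.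
move: cl; rewrite in_cons => /orP [/eqP ->|cl].
  move: fa; case fx: (f d x); case fy: (f d (shift a x)) => // _.
    by exists x, (shift a x); rewrite fx fy; split => // b; lia.
  by exists (shift a x), x; rewrite fx fy; split => // b; lia.
have [y [z [hy hz fy fz]]] := IH _ _ rest cl.
have grow b w : shift a x b <= w <= shift a x b + (b \in S :\ a) ->
    x b <= w <= x b + (b \in S).
  rewrite /shift in_setD1; case: eqP => [->|_] /=; first by rewrite aS; lia.
  by lia.
by exists y, z; split => // b; apply: grow.
Qed.

Lemma iter_shift_other k a b x : b != a -> iter k (shift a) x b = x b.
Proof. by move=> ba; elim: k => //= k IH; rewrite /shift (negbTE ba) addn0. Qed.

(** * Sums over a grid and Stokes' formula *)

Variable m : nat.

Fixpoint gridsum (s : seq I) (F : (I -> nat) -> bool) (x : I -> nat) : bool :=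
  if s is a :: s' then
    \big[addb/false]_(t < m) gridsum s' F (iter t (shift a) x)
  else F x.

Lemma eq_gridsum s F F' x :
  (forall y, (forall b, b \notin s -> y b = x b) -> F y = F' y) ->
  gridsum s F x = gridsum s F' x.
Proof.
elim: s x => [|a s IH] x eqF /=; first by apply: eqF.
apply: eq_bigr => t _; apply: IH => y hy; apply: eqF => b.
rewrite in_cons negb_or => /andP [ba bs]; by rewrite hy // iter_shift_other.
Qed.

Lemma gridsum_add s F F' x :
  gridsum s (fun y => F y (+) F' y) x = gridsum s F x (+) gridsum s F' x.
Proof.
elim: s x => [|a s IH] x //=; rewrite -big_split /=.
by apply: eq_bigr => t _; rewrite IH.
Qed.

Lemma gridsum_false s x : gridsum s (fun=> false) x = false.
Proof. by elim: s x => [|a s IH] x //=; rewrite big1. Qed.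

Lemma gridsum_sum s (S : {set I}) (F : I -> (I -> nat) -> bool) x :
  gridsum s (fun y => \big[addb/false]_(a in S) F a y) x =
  \big[addb/false]_(a in S) gridsum s (F a) x.
Proof.
elim: s x => [|a s IH] x //=; rewrite exchange_big /=.
by apply: eq_bigr => t _; rewrite IH.
Qed.

Lemma iter_shiftC k a b x : iter k (shift a) (shift b x) = shift b (iter k (shift a) x).
Proof. by elim: k => //= k ->; rewrite shiftC. Qed.

Lemma gridsum_shift s F a x :
  gridsum s (fun y => F (shift a y)) x = gridsum s F (shift a x).
Proof.
elim: s x => [|b s IH] x //=; apply: eq_bigr => t _.
by rewrite IH iter_shiftC.
Qed.

Lemma gridsum_iter_shift s F a k x :
  gridsum s (fun y => F (iter k (shift a) y)) x = gridsum s F (iter k (shift a) x).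
Proof.
elim: k F => //= k IH F.
by rewrite (IH (fun y => F (shift a y))) gridsum_shift.
Qed.

(** Differences in direction [a] telescope, leaving the two faces perpendicular to [a], summed over
    the remaining directions. *)
Lemma gridsum_telescope s F a x : a \in s ->
  gridsum s (fun y => F (shift a y) (+) F y) x =
  gridsum (rem a s) (fun y => F (iter m (shift a) y) (+) F y) x.
Proof.
elim: s x => [|b s IH] x //=; rewrite in_cons eq_sym.
case: eqP => [-> _|_ /= as_]; last by apply: eq_bigr => t _; apply: IH.
rewrite gridsum_add gridsum_iter_shift.
elim: m => [|k IHk]; first by rewrite big_ord0 addbb.
rewrite big_ord_recr /= IHk gridsum_add gridsum_shift.
by case: (gridsum _ _ _); case: (gridsum _ _ _); case: (gridsum _ _ _).
Qed.

Lemma iter_shift_same k a x : iter k (shift a) x a = x a + k.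
Proof. by elim: k => [|k IH] /=; rewrite ?addn0 // /shift eqxx IH; lia. Qed.

Hypothesis f0 : forall a x, x a = 0 -> f a x.
Hypothesis fm : forall a x, x a = m -> ~~ f a x.

(** Stokes' formula reduces the sum to the boundary. On faces perpendicular to some [b] other than
    [a], the factor [f b] is constant; on the face [m] of direction [a], [f a] is false. On the face
    [0], [f a] is true, which leaves the same sum in one dimension less. *)
Lemma gridsum_cup s x : uniq s -> (forall a, a \in s -> x a = 0) ->
  gridsum s (cup s [set a in s]) x.
Proof.
elim: s x => [|a s IH] x //; rewrite cons_uniq => /andP [as_ us] x0.
set S := [set _ in _]; pose H b y := f a y && cup s (S :\ b) y.
(* By [cup_closed] the cup products multiplied by [f a y] may be evaluated at [y] itself, which
   makes the summand the coboundary of [H]. *)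
have -> : gridsum (a :: s) (cup (a :: s) S) x =
   gridsum (a :: s) (fun y => \big[addb/false]_(b in S) (H b (shift b y) (+) H b y)) x.
  apply: eq_gridsum => y _ /=.
  under eq_bigr => b _ do rewrite andb_addl.
  rewrite big_split /= -big_distrr /= cup_closed big_distrr /= -big_split /=.
  by apply: eq_bigr.
have aS : a \in S by rewrite inE mem_head.
rewrite gridsum_sum (big_setD1 _ aS) [X in _ _ X]big1 => [|b].
  rewrite Monoid.mulm1 gridsum_telescope ?mem_head //= eqxx.
  rewrite (@eq_gridsum _ _ (cup s [set b in s])).
    by apply: IH => // b bs; apply: x0; rewrite in_cons bs orbT.
  move=> y /(_ a as_); rewrite x0 ?mem_head // => ya.
  have Sa : S :\ a = [set b in s].
    apply/setP => b; rewrite !inE; case: eqP => [->|_] //=; exact/esym/negbTE.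
  have -> : H a (iter m (shift a) y) = false.
    by apply/negbTE; rewrite negb_and fm // iter_shift_same ya.
  by rewrite /H f0 // Sa.
rewrite !inE => /andP [ba]; rewrite (negbTE ba) orFb => bs.
have bas : b \in a :: s by rewrite in_cons bs orbT.
rewrite gridsum_telescope; last exact: bas.
rewrite -[RHS](gridsum_false (rem b (a :: s)) x).
apply: eq_gridsum => y.
have usa : uniq (a :: s) by rewrite /= as_.
move=> /(_ b); rewrite mem_rem_uniq // inE eqxx x0 // => /(_ isT) yb.
have vanish z v : (v = 0 \/ v = m) -> z b = v -> H b z = false.
  move=> hv zb; rewrite /H (@cup_const b v) ?andbF // ?inE ?eqxx //.
  case: hv => -> p q pb qb; first by rewrite !f0.
  by rewrite (negbTE (fm _ _ pb)) (negbTE (fm _ _ qb)).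
rewrite (vanish _ m) ?(vanish _ 0) //; try by [left|right].
by rewrite iter_shift_same yb.
Qed.

Lemma gridsum_witness s F x : uniq s -> gridsum s F x ->
  exists2 y, F y & forall b, b \in s -> y b < x b + m.
Proof.
(* The induction needs the coordinates outside the list fixed: [a] is not in the tail, so its
   coordinate stays [x a + t]. *)
suff wit : uniq s -> gridsum s F x ->
    exists2 y, F y & forall b, if b \in s then y b < x b + m else y b == x b.
  move=> us /(wit us) [y Fy hy]; exists y => // b bs.
  by move: (hy b); rewrite bs.
elim: s x => [|a s IH] x /=; first by exists x.
move=> /andP [as_ us] nz.
have /existsP [t ht] : [exists t : 'I_m, gridsum s F (iter t (shift a) x)].
  apply: contraT => /existsPn none; move: nz; rewrite big1 // => t _.
  exact/negbTE.
have [y Fy hy] := IH _ us ht; exists y => // b.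
move: (hy b); rewrite in_cons; have [->|ba] := eqVneq b a.
  by rewrite (negbTE as_) iter_shift_same => /eqP -> /=; rewrite ltn_add2l.
by rewrite /= iter_shift_other.
Qed.

(** The total over the grid is odd, so some unit cube has a nonzero cup product. *)
Lemma discrete_poincare_miranda_finType :
  exists2 x, forall a, x a < m &
    forall c, exists y z, [/\ forall b, x b <= y b <= (x b).+1,
      forall b, x b <= z b <= (x b).+1, f c y & ~~ f c z].
Proof.
have /gridsum_witness : gridsum (enum I) (cup (enum I) [set a in enum I]) (fun=> 0).
  by apply: gridsum_cup => //; apply: enum_uniq.
move=> /(_ (enum_uniq _)) [x nz hx]; exists x => [a|c].
  by apply: hx; rewrite mem_enum.
have [|y [z [hy hz fy fz]]] := cup_nonzero _ _ _ c nz; first by rewrite mem_enum.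
by exists y, z; split => // b; [move: (hy b)|move: (hz b)]; lia.
Qed.
End Cochain.

Lemma discrete_poincare_miranda_nat (n m : nat) (P : nat -> (nat -> nat) -> Prop) :
  (forall a x, (a < n)%coq_nat -> x a = 0 -> P a x) ->
  (forall a x, (a < n)%coq_nat -> x a = m -> ~ P a x) ->
  exists x, (forall a, (a < n)%coq_nat -> (x a < m)%coq_nat) /\
    forall c, (c < n)%coq_nat -> exists y z,
      (forall b, (b < n)%coq_nat -> (x b <= y b)%coq_nat /\ (y b <= S (x b))%coq_nat) /\
      (forall b, (b < n)%coq_nat -> (x b <= z b)%coq_nat /\ (z b <= S (x b))%coq_nat) /\
      P c y /\ ~ P c z.
Proof.
move=> P0 Pm.
(* Coordinates from [n] on are filled with 0. *)
pose ext (x : 'I_n -> nat) b := if insub b is Some o then x o else 0.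
have extE x (o : 'I_n) : ext x o = x o by rewrite /ext valK.
pose f (o : 'I_n) x : bool := excluded_middle_informative (P o (ext x)).
have fP (o : 'I_n) x : reflect (P o (ext x)) (f o x).
  by rewrite /f; case: excluded_middle_informative => h; constructor.
have lt (o : 'I_n) : (o < n)%coq_nat by apply/ltP.
have [||x hx nonconst] := @discrete_poincare_miranda_finType _ f m.
- by move=> o x xo; apply/fP/P0; rewrite ?extE.
- by move=> o x xo; apply/fP/Pm; rewrite ?extE.
have extI (Q : nat -> nat -> nat -> Prop) (u v : 'I_n -> nat) :
    (forall o : 'I_n, Q o (u o) (v o)) -> forall b, (b < n)%coq_nat -> Q b (ext u b) (ext v b).
  by move=> h b /ltP bn; have := h (Ordinal bn); rewrite -(extE u) -(extE v).
exists (ext x); split => [|c cn].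
  by apply: (extI (fun _ u _ => (u < m)%coq_nat) x x) => o; apply/ltP.
move/ltP: cn => cn; have [y [z [hy hz /fP fy /fP fz]]] := nonconst (Ordinal cn).
exists (ext y), (ext z); split; [|split=> //].
  by apply: (extI (fun _ u v => (u <= v)%coq_nat /\ (v <= S u)%coq_nat)) => o; move: (hy o); lia.
by apply: (extI (fun _ u v => (u <= v)%coq_nat /\ (v <= S u)%coq_nat)) => o; move: (hz o); lia.
Qed.

End DiscretePoincareMiranda.

(** * The direct sum and its metric *)

Local Open Scope Z_scope.

(** * Distance to zero in a cyclic group *)

Definition circ (M z : Z) : Z := Z.min (z mod M) (M - z mod M).

(** This identifies [circ M z] as the distance from [z] to the nearest multiple of [M], which makes
    symmetry and the triangle inequality easy. *)
Lemma circ_spec (M z : Z) : 0 < M ->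
  (exists k, circ M z = Z.abs (z - k * M)) /\ forall k, circ M z <= Z.abs (z - k * M).
Proof.
  intros HM; unfold circ.
  pose proof (Z.div_mod z M ltac:(lia)) as Hz.
  pose proof (Z.mod_pos_bound z M HM) as Hb.
  split.
  - destruct (Z.le_gt_cases (z mod M) (M - z mod M)).
    + exists (z / M). lia.
    + exists (z / M + 1). lia.
  - intros k. destruct (Z.le_gt_cases k (z / M)); nia.
Qed.

Lemma circ_nonneg (M z : Z) : 0 < M -> 0 <= circ M z.
Proof. intros HM. destruct (circ_spec M z HM) as [[k ->] _]. lia. Qed.

Lemma circ_le_modulus (M z : Z) : 0 < M -> circ M z <= M.
Proof. intros HM. unfold circ. pose proof (Z.mod_pos_bound z M HM). lia. Qed.

Lemma circ_eq0 (M z : Z) : 0 < M -> circ M z = 0 -> z mod M = 0.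
Proof.
  intros HM. unfold circ. pose proof (Z.mod_pos_bound z M HM). lia.
Qed.

Lemma circ_0 (M : Z) : 0 < M -> circ M 0 = 0.
Proof. intros HM. unfold circ. rewrite Z.mod_0_l; lia. Qed.

Lemma circ_opp (M z : Z) : 0 < M -> circ M (- z) = circ M z.
Proof.
  intros HM.
  destruct (circ_spec M z HM) as [[k Hk] H], (circ_spec M (- z) HM) as [[l Hl] H'].
  specialize (H (- l)); specialize (H' (- k)). lia.
Qed.

Lemma circ_add (M z w : Z) : 0 < M -> circ M (z + w) <= circ M z + circ M w.
Proof.
  intros HM.
  destruct (circ_spec M z HM) as [[k ->] _], (circ_spec M w HM) as [[l ->] _].
  destruct (circ_spec M (z + w) HM) as [_ H]. specialize (H (k + l)). lia.
Qed.

Lemma circ_small (M z : Z) : 0 < M -> 2 * Z.abs z <= M -> circ M z = Z.abs z.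
Proof.
  intros HM Hz. destruct (circ_spec M z HM) as [[k Hk] H].
  specialize (H 0). assert (k = 0 \/ 1 <= Z.abs k) as [->|] by lia; nia.
Qed.

Lemma circ_congr (M z w k : Z) : 0 < M -> z = w + k * M -> circ M z = circ M w.
Proof. intros HM ->. unfold circ. rewrite Z.mod_add; lia. Qed.

(** * Moduli and scales of the levels *)

Definition modulus (i : nat) : Z := 2 ^ Z.of_nat i.
Definition scale (i : nat) : Z := 2 ^ Z.of_nat (i * i).

Lemma modulus_pos i : 0 < modulus i.
Proof. apply Z.pow_pos_nonneg; lia. Qed.

Lemma scale_pos i : 0 < scale i.
Proof. apply Z.pow_pos_nonneg; lia. Qed.

(** This is [i * i + i <= j * j] in the exponents; the left-hand side bounds the diameter of level
    [i]. *)
Lemma scale_gap i j : (i < j)%nat -> scale i * modulus i <= scale j.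
Proof.
  intros H. unfold scale, modulus. rewrite <- Z.pow_add_r by lia.
  apply Z.pow_le_mono_r; nia.
Qed.

Lemma scale_ge i : Z.of_nat i <= scale i.
Proof.
  apply Z.le_trans with (2 ^ Z.of_nat i).
  - apply Z.lt_le_incl, Z.pow_gt_lin_r; lia.
  - apply Z.pow_le_mono_r; nia.
Qed.

Section DirectSum.
Variable dim : nat -> nat.

(** Coordinates are canonical residues and indices from [dim i] on carry 0, so equality of elements
    is pointwise equality, without quotients or dependent types. *)
Definition is_elt (f : nat -> nat -> Z) : Prop :=
  (forall i a, 0 <= f i a < modulus i) /\
  (forall i a, (dim i <= a)%nat -> f i a = 0) /\
  exists b, forall i a, (b <= i)%nat -> f i a = 0.

Definition elt : Type := {f : nat -> nat -> Z | is_elt f}.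

Definition coord (x : elt) : nat -> nat -> Z := proj1_sig x.

Lemma elt_ext (x y : elt) : (forall i a, coord x i a = coord y i a) -> x = y.
Proof.
  destruct x as [f Hf], y as [g Hg]; simpl; intros H.
  apply subset_eq_compat. do 2 (apply functional_extensionality; intro). apply H.
Qed.

Lemma coord_range x i a : 0 <= coord x i a < modulus i.
Proof. apply (proj2_sig x). Qed.

Lemma coord_out x i a : (dim i <= a)%nat -> coord x i a = 0.
Proof. apply (proj2_sig x). Qed.

Lemma coord_mod x i a : coord x i a mod modulus i = coord x i a.
Proof. apply Z.mod_small, coord_range. Qed.

Lemma coord_eq_of_circ x y i a :
  circ (modulus i) (coord y i a - coord x i a) = 0 -> coord x i a = coord y i a.
Proof.
  intros H. pose proof (modulus_pos i).
  apply circ_eq0 in H; [|assumption].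
  apply Z.mod_divide in H; [|lia]. destruct H as [k Hk].
  pose proof (coord_range x i a). pose proof (coord_range y i a).
  assert (k = 0) by nia. subst k. lia.
Qed.

Definition reduce (f : nat -> nat -> Z) (i a : nat) : Z :=
  if le_dec (dim i) a then 0 else f i a mod modulus i.

Lemma reduce_elt (f : nat -> nat -> Z) :
  (exists b, forall i a, (b <= i)%nat -> f i a = 0) -> is_elt (reduce f).
Proof.
  intros [b Hb]. unfold reduce. split; [|split].
  - intros i a. pose proof (modulus_pos i).
    destruct le_dec; [lia|]. apply Z.mod_pos_bound; assumption.
  - intros i a H. destruct le_dec; [reflexivity|contradiction].
  - exists b. intros i a H. rewrite Hb by assumption.
    destruct le_dec; [reflexivity|]. apply Z.mod_0_l. pose proof (modulus_pos i); lia.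
Qed.

Lemma add_support (x y : elt) :
  exists b, forall i a, (b <= i)%nat -> coord x i a + coord y i a = 0.
Proof.
  destruct (proj2_sig x) as (_ & _ & b & Hf), (proj2_sig y) as (_ & _ & c & Hg).
  exists (max b c). intros i a H. unfold coord. rewrite Hf, Hg; lia.
Qed.

Lemma opp_support (x : elt) :
  exists b, forall i a, (b <= i)%nat -> - coord x i a = 0.
Proof.
  destruct (proj2_sig x) as (_ & _ & b & Hf).
  exists b. intros i a H. unfold coord. rewrite Hf; lia.
Qed.

Lemma zero_support : exists b : nat, forall i a : nat, (b <= i)%nat -> 0 = 0.
Proof. exists O; reflexivity. Qed.

Definition eadd (x y : elt) : elt := exist _ _ (reduce_elt _ (add_support x y)).
Definition eopp (x : elt) : elt := exist _ _ (reduce_elt _ (opp_support x)).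
Definition ezero : elt := exist _ _ (reduce_elt (fun _ _ => 0) zero_support).

Lemma coord_add x y i a : coord (eadd x y) i a = (coord x i a + coord y i a) mod modulus i.
Proof.
  unfold eadd, coord at 1; simpl. unfold reduce. destruct le_dec; [|reflexivity].
  rewrite !coord_out by assumption. symmetry. apply Z.mod_0_l.
  pose proof (modulus_pos i); lia.
Qed.

Lemma coord_opp x i a : coord (eopp x) i a = (- coord x i a) mod modulus i.
Proof.
  unfold eopp, coord at 1; simpl. unfold reduce. destruct le_dec; [|reflexivity].
  rewrite !coord_out by assumption. symmetry. apply Z.mod_0_l.
  pose proof (modulus_pos i); lia.
Qed.

Lemma coord_zero i a : coord ezero i a = 0.
Proof.
  unfold ezero, coord; simpl. unfold reduce. destruct le_dec; [reflexivity|].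
  apply Z.mod_0_l. pose proof (modulus_pos i); lia.
Qed.

Lemma eadd_assoc x y z : eadd x (eadd y z) = eadd (eadd x y) z.
Proof.
  apply elt_ext; intros i a. rewrite !coord_add.
  rewrite Zplus_mod_idemp_l, Zplus_mod_idemp_r. f_equal; lia.
Qed.

Lemma eadd_comm x y : eadd x y = eadd y x.
Proof. apply elt_ext; intros i a. rewrite !coord_add. f_equal; lia. Qed.

Lemma eadd_zero_l x : eadd ezero x = x.
Proof. apply elt_ext; intros i a. rewrite coord_add, coord_zero. apply coord_mod. Qed.

Lemma eadd_opp_l x : eadd (eopp x) x = ezero.
Proof.
  apply elt_ext; intros i a. rewrite coord_add, coord_opp, coord_zero.
  rewrite Zplus_mod_idemp_l, Z.add_opp_diag_l. apply Z.mod_0_l.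
  pose proof (modulus_pos i); lia.
Qed.

Definition dsum : Group.
Proof.
  refine (@Build_Group elt eadd ezero eopp eadd_assoc eadd_zero_l _ eadd_opp_l _).
  - intros x. rewrite eadd_comm. apply eadd_zero_l.
  - intros x. rewrite eadd_comm. apply eadd_opp_l.
Defined.

Definition supported (b : nat) (x : elt) : Prop :=
  forall i a, (b <= i)%nat -> coord x i a = 0.

Lemma norm_exists (x : elt) : exists r : nat,
  (forall i a, scale i * circ (modulus i) (coord x i a) <= Z.of_nat r) /\
  forall r', (forall i a, scale i * circ (modulus i) (coord x i a) <= Z.of_nat r') ->
    (r <= r')%nat.
Proof.
  pose (P r := forall i a, scale i * circ (modulus i) (coord x i a) <= Z.of_nat r).
  destruct (Wf_nat.dec_inh_nat_subset_has_unique_least_element P) as [r [[Hr Hmin] _]].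
  - intros r. apply classic.
  - destruct (proj2_sig x) as (_ & _ & b & Hb). exists (Z.to_nat (scale b)).
    intros i a. pose proof (scale_pos i). pose proof (scale_pos b).
    pose proof (modulus_pos i). rewrite Z2Nat.id by lia.
    destruct (le_lt_dec b i) as [H2|H2].
    + unfold coord; rewrite Hb, circ_0 by assumption. lia.
    + pose proof (circ_le_modulus (modulus i) (coord x i a) ltac:(assumption)).
      pose proof (scale_gap i b H2). nia.
  - exists r. split; assumption.
Qed.

(** The supremum of the scaled coordinate distances; these are integers, so it is a least natural
    upper bound. *)
Definition norm (x : elt) : nat :=
  proj1_sig (constructive_indefinite_description _ (norm_exists x)).

Lemma norm_le (x : elt) (r : nat) :
  (norm x <= r)%nat <->
  forall i a, scale i * circ (modulus i) (coord x i a) <= Z.of_nat r.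
Proof.
  unfold norm. destruct constructive_indefinite_description as [n [H1 H2]]; simpl.
  split; [|apply H2]. intros H i a. specialize (H1 i a). lia.
Qed.

Definition dist (x y : elt) : R := INR (norm (eadd (eopp x) y)).

Lemma norm_diff_le (x y : elt) (r : nat) :
  (norm (eadd (eopp x) y) <= r)%nat <->
  forall i a, scale i * circ (modulus i) (coord y i a - coord x i a) <= Z.of_nat r.
Proof.
  rewrite norm_le.
  assert (E : forall i a, circ (modulus i) (coord (eadd (eopp x) y) i a) =
                circ (modulus i) (coord y i a - coord x i a)).
  { intros i a. rewrite coord_add, coord_opp, Zplus_mod_idemp_l.
    pose proof (modulus_pos i).
    apply (circ_congr _ _ _ (- ((- coord x i a + coord y i a) / modulus i))); [lia|].
    pose proof (Z.div_mod (- coord x i a + coord y i a) (modulus i) ltac:(lia)). lia. }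
  split; intros H i a; [rewrite <- E|rewrite E]; apply H.
Qed.

Lemma dist_le (x y : elt) (r : R) : (0 <= r)%R ->
  (forall i a, IZR (scale i * circ (modulus i) (coord y i a - coord x i a)) <= r)%R ->
  (dist x y <= r)%R.
Proof.
  intros Hr H. unfold dist.
  (* [n] is the integer part of [r], and bounds the same integers as [r]. *)
  assert (Hf : exists n : nat, (INR n <= r < INR n + 1)%R).
  { destruct (archimed r) as [H1 H2]. exists (Z.to_nat (up r - 1)).
    assert (0 < up r) by (apply lt_IZR; lra).
    rewrite INR_IZR_INZ, Z2Nat.id, minus_IZR by lia. lra. }
  destruct Hf as [n [Hn1 Hn2]].
  apply Rle_trans with (INR n); [apply le_INR|assumption].
  apply norm_diff_le. intros i a. specialize (H i a).
  rewrite INR_IZR_INZ in Hn2.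
  assert (scale i * circ (modulus i) (coord y i a - coord x i a) < Z.of_nat n + 1); [|lia].
  apply lt_IZR. rewrite plus_IZR. lra.
Qed.

Lemma dist_ge (x y : elt) i a :
  (IZR (scale i * circ (modulus i) (coord y i a - coord x i a)) <= dist x y)%R.
Proof.
  unfold dist. rewrite INR_IZR_INZ. apply IZR_le.
  apply norm_diff_le. apply le_n.
Qed.

Lemma dist_nonneg x y : (0 <= dist x y)%R.
Proof. apply pos_INR. Qed.

Lemma dist_is_metric : is_metric dist.
Proof.
  split; [apply dist_nonneg|split; [|split]].
  - intros x y; split.
    + intros H. apply elt_ext; intros i a.
      pose proof (dist_ge x y i a) as Hge. rewrite H in Hge. apply le_IZR in Hge.
      pose proof (modulus_pos i). pose proof (scale_pos i).
      pose proof (circ_nonneg (modulus i) (coord y i a - coord x i a) ltac:(lia)).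
      apply coord_eq_of_circ. nia.
    + intros ->. apply Rle_antisym; [|apply dist_nonneg].
      apply dist_le; [lra|]. intros i a. rewrite Z.sub_diag, circ_0 by apply modulus_pos.
      rewrite Z.mul_0_r. lra.
  - assert (Hs : forall x y, (dist x y <= dist y x)%R).
    { intros x y. apply dist_le; [apply dist_nonneg|]. intros i a.
      rewrite <- circ_opp by apply modulus_pos. rewrite Z.opp_sub_distr, Z.add_comm.
      apply dist_ge. }
    intros x y. apply Rle_antisym; apply Hs.
  - intros x y z. apply dist_le.
    + apply Rplus_le_le_0_compat; apply dist_nonneg.
    + intros i a. apply Rle_trans with
        (IZR (scale i * circ (modulus i) (coord y i a - coord x i a)) +
         IZR (scale i * circ (modulus i) (coord z i a - coord y i a)))%R.
      * rewrite <- plus_IZR, <- Z.mul_add_distr_l. apply IZR_le.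
        apply Z.mul_le_mono_nonneg_l; [pose proof (scale_pos i); lia|].
        replace (coord z i a - coord x i a) with
          ((coord y i a - coord x i a) + (coord z i a - coord y i a)) by lia.
        apply circ_add, modulus_pos.
      * apply Rplus_le_compat; apply dist_ge.
Qed.

Lemma dist_left_invariant g x y : dist (eadd g x) (eadd g y) = dist x y.
Proof.
  assert (H : forall i a, circ (modulus i) (coord (eadd g y) i a - coord (eadd g x) i a) =
                circ (modulus i) (coord y i a - coord x i a)).
  { intros i a. rewrite !coord_add. pose proof (modulus_pos i).
    apply (circ_congr _ _ _ ((coord g i a + coord x i a) / modulus i
                           - (coord g i a + coord y i a) / modulus i)); [lia|].
    pose proof (Z.div_mod (coord g i a + coord x i a) (modulus i) ltac:(lia)).
    pose proof (Z.div_mod (coord g i a + coord y i a) (modulus i) ltac:(lia)). lia. }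
  apply Rle_antisym; apply dist_le; try apply dist_nonneg; intros i a.
  - rewrite H. apply dist_ge.
  - rewrite <- H. apply dist_ge.
Qed.

(** * Local finiteness and finiteness of balls *)

Lemma finite_lists {A : Type} (L : list A) (k : nat) :
  finite_pred (fun l => length l = k /\ forall z, In z l -> In z L).
Proof.
  induction k as [|k [E HE]].
  - exists (nil :: nil). intros [|z l] [H _]; [left; reflexivity|discriminate].
  - exists (flat_map (fun z => map (cons z) E) L). intros [|z l] [Hl HL]; [discriminate|].
    apply in_flat_map. exists z. split; [apply HL; left; reflexivity|].
    apply in_map, HE. split; [injection Hl; auto|]. intros w Hw. apply HL. right; exact Hw.
Qed.

Lemma finite_pred_inj {X Y : Type} (F : X -> Y) (P : X -> Prop) (Q : Y -> Prop) :
  finite_pred Q -> (forall x, P x -> Q (F x)) ->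
  (forall x x', P x -> P x' -> F x = F x' -> x = x') -> finite_pred P.
Proof.
  intros [E HE] HPQ Hinj.
  assert (H : exists L, forall x, P x -> In (F x) E -> In x L).
  { clear HE. induction E as [|y E [L HL]].
    - exists nil. intros x _ [].
    - destruct (classic (exists x, P x /\ F x = y)) as [[x0 [H0 <-]]|Hn].
      + exists (x0 :: L). intros x Hx [H|H]; [left; auto|right; auto].
      + exists L. intros x Hx [H|H]; [|auto]. exfalso. apply Hn. exists x. auto. }
  destruct H as [L HL]. exists L. intros x Hx. apply HL; auto.
Qed.

Lemma finite_supported (b : nat) : finite_pred (supported b).
Proof.
  pose (J := flat_map (fun i => map (pair i) (seq 0 (dim i))) (seq 0 b)).
  pose (F x := map (fun p => coord x (fst p) (snd p)) J).
  apply (finite_pred_inj F _ _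
    (finite_lists (map Z.of_nat (seq 0 (Z.to_nat (modulus b)))) (length J))).
  - intros x _. unfold F. split; [apply length_map|].
    intros z Hz. apply in_map_iff in Hz. destruct Hz as [[i a] [<- Hp]]. simpl.
    apply in_flat_map in Hp. destruct Hp as [i' [Hi Hp]].
    apply in_map_iff in Hp. destruct Hp as [a' [[= -> ->] _]]. apply in_seq in Hi.
    pose proof (coord_range x i a).
    assert (modulus i <= modulus b) by (apply Z.pow_le_mono_r; lia).
    apply in_map_iff. exists (Z.to_nat (coord x i a)). split; [lia|].
    apply in_seq. lia.
  - intros x y Hx Hy HF. apply elt_ext. intros i a.
    destruct (le_lt_dec b i); [rewrite Hx, Hy by assumption; reflexivity|].
    destruct (le_lt_dec (dim i) a); [rewrite !coord_out by assumption; reflexivity|].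
    assert (Hp : In (i, a) J).
    { apply in_flat_map. exists i. split; [apply in_seq; lia|].
      apply in_map, in_seq. lia. }
    apply (ext_in_map HF (i, a) Hp).
Qed.

(** Finitely many generators vanish from a common level [b] on, and the group operations preserve
    this. *)
Lemma dsum_locally_finite : locally_finite dsum.
Proof.
  intros S.
  assert (Hb : exists b, forall x, In x S -> supported b x).
  { induction S as [|x S [b Hb]].
    - exists O. intros x [].
    - destruct (proj2_sig x) as (_ & _ & c & Hc). exists (max b c).
      intros y [<-|Hy] i a Hi; [apply Hc; lia|apply Hb; [assumption|lia]]. }
  destruct Hb as [b Hb]. destruct (finite_supported b) as [L HL].
  exists L. intros x Hx. apply HL. induction Hx; simpl.
  - auto.
  - intros i a _. apply coord_zero.
  - intros i a Hi. change (coord (eopp x) i a = 0). rewrite coord_opp, IHHx by assumption.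
    apply Z.mod_0_l. pose proof (modulus_pos i); lia.
  - intros i a Hi. change (coord (eadd x y) i a = 0).
    rewrite coord_add, IHHx1, IHHx2 by assumption.
    apply Z.mod_0_l. pose proof (modulus_pos i); lia.
Qed.

(** After translating [x] to zero, a nonzero coordinate at a level [i >= b] would force the norm to
    be at least [scale i >= b > r]. *)
Lemma dist_proper x (r : R) : finite_pred (fun y => (dist x y <= r)%R).
Proof.
  destruct (INR_unbounded r) as [b Hb].
  apply (finite_pred_inj (fun y => eadd (eopp x) y) _ _ (finite_supported b)).
  - intros y Hy i a Hi. unfold dist in Hy.
    assert (Hn : (norm (eadd (eopp x) y) < b)%nat) by (apply INR_lt; lra).
    pose proof (proj1 (norm_le (eadd (eopp x) y) _) (le_n _) i a) as H.
    set (z := coord (eadd (eopp x) y) i a) in *.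
    assert (Hz : 0 <= z < modulus i) by apply coord_range.
    pose proof (circ_nonneg (modulus i) z ltac:(lia)).
    pose proof (scale_ge i).
    rewrite <- (Z.mod_small _ _ Hz). apply circ_eq0; [lia|]. nia.
  - intros y y' _ _ H.
    assert (E : forall z, eadd x (eadd (eopp x) z) = z).
    { intros z. rewrite eadd_assoc, (eadd_comm x), eadd_opp_l. apply eadd_zero_l. }
    rewrite <- (E y), H. apply E.
Qed.

Lemma dist_proper_left_invariant : proper_left_invariant_metric dsum dist.
Proof.
  split; [exact dist_is_metric|]. split; [exact dist_left_invariant|exact dist_proper].
Qed.

(** * Upper bound *)

Lemma chain_head {X : Type} (d : X -> X -> R) U s x y : s_chain d U s x y -> U x.
Proof. intros []; assumption. Qed.

Lemma chain_invariant {X Y : Type} (d : X -> X -> R) U s (h : X -> Y) :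
  (forall x y, U x -> U y -> (d x y < s)%R -> h x = h y) ->
  forall x y, s_chain d U s x y -> h x = h y.
Proof.
  intros Hh x y Hc. induction Hc as [|x y z Hx Hxy Hc IH]; [reflexivity|].
  rewrite (Hh x y Hx (chain_head _ _ _ _ _ Hc) Hxy). exact IH.
Qed.

(* The positions [z] with [(z - c) mod L < t] are walls of width [t], one in each
   period [L]; steps shorter than [t] cannot cross them. *)
Lemma wall_step (q L t c x y : Z) : 0 < q -> 0 < L ->
  circ (q * L) (y - x) < t -> ~ (x - c) mod L < t -> ~ (y - c) mod L < t ->
  ((x - c) / L) mod q = ((y - c) / L) mod q.
Proof.
  intros Hq HL Hxy Hx Hy.
  destruct (circ_spec (q * L) (y - x) ltac:(nia)) as [[k Hk] _].
  (* [k] counts turns around the cycle. Points of different cells are separated by a whole wall,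
     hence by at least [t]. *)
  assert (E : (y - c) / L = (x - c) / L + k * q).
  { pose proof (Z.div_mod (x - c) L ltac:(lia)). pose proof (Z.mod_pos_bound (x - c) L HL).
    pose proof (Z.div_mod (y - c) L ltac:(lia)). pose proof (Z.mod_pos_bound (y - c) L HL).
    set (u := (x - c) / L) in *. set (v := (y - c) / L) in *.
    destruct (Z.lt_trichotomy v (u + k * q)) as [H'|[H'|H']]; [|assumption|];
    exfalso; nia. }
  rewrite E. rewrite Z.mod_add; lia.
Qed.

Lemma same_cell_close (q L c x y : Z) : 0 < q -> 0 < L ->
  ((x - c) / L) mod q = ((y - c) / L) mod q -> circ (q * L) (y - x) <= L.
Proof.
  intros Hq HL E.
  pose proof (Z.div_mod (x - c) L ltac:(lia)). pose proof (Z.mod_pos_bound (x - c) L HL).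
  pose proof (Z.div_mod (y - c) L ltac:(lia)). pose proof (Z.mod_pos_bound (y - c) L HL).
  pose proof (Z.div_mod ((x - c) / L) q ltac:(lia)).
  pose proof (Z.div_mod ((y - c) / L) q ltac:(lia)).
  set (u := (x - c) / L) in *. set (v := (y - c) / L) in *.
  destruct (circ_spec (q * L) (y - x) ltac:(nia)) as [_ Hk].
  specialize (Hk (v / q - u / q)).
  assert (v - u = q * (v / q - u / q)) by lia.
  assert (L * v - L * u = (v / q - u / q) * (q * L)) by nia. lia.
Qed.

(** The walls of different families are disjoint: the block of width [t] containing [z] within its
    period determines [j]. *)
Lemma wall_index (N t z : Z) (j : Z) : 0 < t -> 0 <= j < N ->
  (z - j * t) mod (N * t) < t -> (z mod (N * t)) / t = j.
Proof.
  intros Ht Hj H.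
  pose proof (Z.div_mod (z - j * t) (N * t) ltac:(nia)) as E.
  pose proof (Z.mod_pos_bound (z - j * t) (N * t) ltac:(nia)).
  set (r := (z - j * t) mod (N * t)) in *. set (k := (z - j * t) / (N * t)) in *.
  assert (Hm : z mod (N * t) = j * t + r).
  { symmetry. apply (Z.mod_unique_pos _ _ k); nia. }
  rewrite Hm. symmetry. apply (Z.div_unique_pos _ _ _ r); nia.
Qed.

(** Pigeonhole: [n] coordinates, each spoiling at most one family, leave one of [n + 1] families
    intact. *)
Lemma avoid_values (n : nat) (f : nat -> nat) :
  exists j, (j <= n)%nat /\ forall a, (a < n)%nat -> f a <> j.
Proof.
  apply NNPP. intros H.
  assert (Hi : incl (seq 0 (S n)) (map f (seq 0 n))).
  { intros j Hj. apply in_seq in Hj. apply NNPP. intros Hn. apply H. exists j.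
    split; [lia|]. intros a Ha E. apply Hn. apply in_map_iff. exists a.
    split; [assumption|]. apply in_seq. lia. }
  apply (NoDup_incl_length (seq_NoDup _ _)) in Hi.
  rewrite length_map, !length_seq in Hi. lia.
Qed.

(** Half of the least suitable power is below [s], unless that power is [2 ^ 0]; hence the summand
    1. *)
Lemma pow2_approx (s : R) : (0 < s)%R ->
  exists B : nat, (s <= IZR (2 ^ Z.of_nat B))%R /\ (IZR (2 ^ Z.of_nat B) <= 2 * s + 1)%R.
Proof.
  intros Hs. destruct (INR_unbounded s) as [p Hp].
  assert (Hp' : (s <= IZR (2 ^ Z.of_nat p))%R).
  { apply Rle_trans with (INR p); [lra|]. rewrite INR_IZR_INZ. apply IZR_le.
    apply Z.lt_le_incl, Z.pow_gt_lin_r; lia. }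
  clear Hp. induction p as [|p IH].
  - exists O. simpl in *. lra.
  - destruct (Rle_lt_dec s (IZR (2 ^ Z.of_nat p))) as [H|H]; [auto|].
    exists (S p). split; [assumption|].
    rewrite Nat2Z.inj_succ, Z.pow_succ_r, mult_IZR by lia. lra.
Qed.

(* At scale [2 ^ B], levels with larger [scale] are invisible and levels of small
   diameter are harmless; only an active level needs to be cut. *)
Definition active (n B i : nat) : Prop :=
  scale i < 2 ^ Z.of_nat B /\ 2 ^ Z.of_nat n * 2 ^ Z.of_nat B < scale i * modulus i.

(** For active levels [u < v], [scale_gap] would give [2 ^ B < scale u * modulus u <= scale v < 2 ^
    B]. *)
Lemma active_unique n B i j : active n B i -> active n B j -> i = j.
Proof.
  assert (H : forall i j, active n B i -> active n B j -> ~ (i < j)%nat).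
  { intros u v [_ H1] [H2 _] Huv. pose proof (scale_gap u v Huv).
    assert (1 <= 2 ^ Z.of_nat n) by (apply Z.lt_pred_le, Z.pow_pos_nonneg; lia).
    assert (0 < 2 ^ Z.of_nat B) by (apply Z.pow_pos_nonneg; lia). nia. }
  intros Hi Hj. pose proof (H i j Hi Hj). pose proof (H j i Hj Hi). lia.
Qed.

(** The length [2 ^ B] in unit steps of level [i]. On an active level [i * i < B], so the truncated
    subtraction is exact. *)
Definition wall_width (B i : nat) : Z := 2 ^ Z.of_nat (B - i * i).

(** All quantities are powers of two, so the wall period divides the modulus and the walls close up
    around the cycle. *)
Lemma active_spec n B i : active n B i ->
  0 < wall_width B i /\ scale i * wall_width B i = 2 ^ Z.of_nat B /\
  exists q, 0 < q /\ modulus i = q * (2 ^ Z.of_nat n * wall_width B i).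
Proof.
  intros [H1 H2]. unfold scale, modulus, wall_width in *.
  rewrite <- !Z.pow_add_r in H2 by lia.
  apply Z.pow_lt_mono_r_iff in H1, H2; try lia.
  split; [apply Z.pow_pos_nonneg; lia|]. split.
  - rewrite <- Z.pow_add_r by lia. f_equal. lia.
  - exists (2 ^ (Z.of_nat i - Z.of_nat n - Z.of_nat (B - i * i))).
    split; [apply Z.pow_pos_nonneg; lia|].
    rewrite <- !Z.pow_add_r by lia. f_equal. lia.
Qed.

Lemma dist_lt_circ x y s B i a : (dist x y < s)%R -> (s <= IZR (2 ^ Z.of_nat B))%R ->
  scale i * circ (modulus i) (coord y i a - coord x i a) < 2 ^ Z.of_nat B.
Proof. intros H1 H2. apply lt_IZR. pose proof (dist_ge x y i a). lra. Qed.

Lemma dsum_asdimAN_le n : (forall i, (dim i <= n)%nat) -> asdimAN_le dist n.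
Proof.
  intros Hdim. pose (N := 2 ^ Z.of_nat n).
  assert (HN : 0 < N) by (apply Z.pow_pos_nonneg; lia).
  assert (HnN : Z.of_nat n < N) by (apply Z.pow_gt_lin_r; lia).
  (* Components will have diameter at most [N * 2 ^ B], and [2 ^ B <= 2 * s + 1]. *)
  exists (2 * IZR N)%R, (IZR N). split; [apply Rmult_lt_0_compat; [lra|apply IZR_lt; lia]|].
  intros s Hs. destruct (pow2_approx s Hs) as [B [HB1 HB2]].
  assert (HB : 0 < 2 ^ Z.of_nat B) by (apply Z.pow_pos_nonneg; lia).
  exists (fun j x => forall i a, active n B i -> (a < dim i)%nat ->
    ~ (coord x i a - Z.of_nat j * wall_width B i) mod (N * wall_width B i) < wall_width B i).
  split.
  - intros x. destruct (classic (exists i, active n B i)) as [[i Hi]|Hno].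
    + destruct (avoid_values n (fun a =>
        Z.to_nat ((coord x i a mod (N * wall_width B i)) / wall_width B i))) as [j [Hj Hf]].
      exists j. split; [assumption|]. intros i' a Hi' Ha Hw.
      rewrite <- (active_unique _ _ _ _ Hi Hi') in Ha, Hw.
      destruct (active_spec _ _ _ Hi) as [Ht _].
      apply (Hf a); [specialize (Hdim i); lia|].
      rewrite (wall_index _ _ _ (Z.of_nat j)) by (assumption || lia). apply Nat2Z.id.
    + exists O. split; [lia|]. intros i a Hi. exfalso. eauto.
  - intros j Hj x y Hc.
    apply Rle_trans with (IZR (N * 2 ^ Z.of_nat B)).
    2: { rewrite mult_IZR. apply IZR_lt in HN. nra. }
    apply dist_le; [apply IZR_le; nia|]. intros i a. apply IZR_le.
    pose proof (scale_pos i). pose proof (modulus_pos i).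
    destruct (Z.lt_ge_cases (scale i) (2 ^ Z.of_nat B)) as [H1|H1].
    + destruct (Z.lt_ge_cases (N * 2 ^ Z.of_nat B) (scale i * modulus i)) as [H2|H2].
      * assert (Hi : active n B i) by (split; assumption).
        destruct (active_spec _ _ _ Hi) as (Ht & HS & q & Hq & HM).
        fold N in HM. set (t := wall_width B i) in *.
        destruct (le_lt_dec (dim i) a) as [Ha|Ha].
        { rewrite !coord_out, circ_0 by assumption. nia. }
        assert (Hcell : circ (modulus i) (coord y i a - coord x i a) <= N * t).
        { rewrite HM. apply (same_cell_close _ _ (Z.of_nat j * t)); [assumption|nia|].
          apply (chain_invariant _ _ _
            (fun z => ((coord z i a - Z.of_nat j * t) / (N * t)) mod q)) in Hc; [exact Hc|].
          intros u v Hu Hv Huv. apply wall_step with t; auto; [nia|].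
          rewrite <- HM. pose proof (dist_lt_circ _ _ _ _ i a Huv HB1). nia. }
        nia.
      * pose proof (circ_le_modulus (modulus i) (coord y i a - coord x i a) ltac:(lia)). nia.
    (* Invisible level: changing a coordinate costs at least [scale i >= 2 ^ B], more than a short
       step allows. *)
    + apply (chain_invariant _ _ _ (fun z => coord z i a)) in Hc.
      * rewrite Hc, Z.sub_diag, circ_0 by assumption. nia.
      * intros u v _ _ Huv. pose proof (dist_lt_circ _ _ _ _ i a Huv HB1).
        pose proof (circ_nonneg (modulus i) (coord v i a - coord u i a) ltac:(lia)).
        apply coord_eq_of_circ. nia.
Qed.

(** * Lower bound *)

Section Box.
Variables (i j m : nat).
Hypothesis j_lt_dim : (j < dim i)%nat.
Hypothesis box_fits : 2 * Z.of_nat m <= modulus i.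

Definition in_box (x : nat -> nat) : Prop := forall a, (a <= j)%nat -> (x a <= m)%nat.

(** The grid is placed in the first [j + 1] coordinates of level [i]. As [2 * m <= modulus i], no
    wrap-around occurs and distances are sup distances times [scale i]. *)
Definition box_coord (x : nat -> nat) (i' a : nat) : Z :=
  if Nat.eq_dec i' i then if le_dec a j then Z.of_nat (x a) else 0 else 0.

Lemma box_support x : exists b, forall i' a, (b <= i')%nat -> box_coord x i' a = 0.
Proof.
  exists (S i). intros i' a H. unfold box_coord. destruct Nat.eq_dec; [lia|reflexivity].
Qed.

Definition box_pt (x : nat -> nat) : elt := exist _ _ (reduce_elt _ (box_support x)).

Lemma coord_box_pt x i' a : in_box x -> coord (box_pt x) i' a = box_coord x i' a.
Proof.
  intros Hx. unfold box_pt, coord; simpl. unfold reduce, box_coord.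
  pose proof (modulus_pos i'). pose proof (modulus_pos i).
  destruct (le_dec (dim i') a), (Nat.eq_dec i' i) as [->|], (le_dec a j); try reflexivity;
    try lia; try (apply Z.mod_0_l; lia).
  apply Z.mod_small. specialize (Hx a ltac:(assumption)). lia.
Qed.

Lemma box_dist_le x y (r : nat) : in_box x -> in_box y ->
  (forall a, (a <= j)%nat -> (x a <= y a + r)%nat /\ (y a <= x a + r)%nat) ->
  (dist (box_pt x) (box_pt y) <= IZR (scale i * Z.of_nat r))%R.
Proof.
  intros Hx Hy Hr. pose proof (scale_pos i).
  apply dist_le; [apply IZR_le; nia|]. intros i' a. apply IZR_le.
  rewrite !coord_box_pt by assumption. unfold box_coord.
  pose proof (modulus_pos i') as HM.
  destruct Nat.eq_dec as [->|]; [destruct le_dec as [Ha|]|].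
  - specialize (Hr a Ha). specialize (Hx a Ha). specialize (Hy a Ha).
    rewrite circ_small by lia. nia.
  - rewrite circ_0 by assumption. nia.
  - rewrite circ_0 by assumption. nia.
Qed.

Lemma box_dist_ge x y a : in_box x -> in_box y -> (a <= j)%nat ->
  (IZR (scale i * (Z.of_nat (x a) - Z.of_nat (y a))) <= dist (box_pt x) (box_pt y))%R.
Proof.
  intros Hx Hy Ha. eapply Rle_trans; [|apply (dist_ge _ _ i a)]. apply IZR_le.
  rewrite !coord_box_pt by assumption. unfold box_coord.
  pose proof (modulus_pos i). pose proof (scale_pos i).
  destruct Nat.eq_dec as [_|]; [|contradiction]. destruct le_dec; [|contradiction].
  specialize (Hx a Ha). specialize (Hy a Ha).
  rewrite circ_small by lia. nia.
Qed.

(* If every component of [U a] failed to join the faces [x a <= 1] and [x a >= m - 1],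
   then the 1-neighbourhoods of the components meeting [x a <= 1] would satisfy the
   hypotheses of the Poincare-Miranda theorem, and the cube it provides would have
   no vertex in any [U a]. *)
Lemma box_long_chain (U : nat -> elt -> Prop) (s : R) :
  (2 <= m)%nat -> (IZR (scale i * 2) < s)%R ->
  (forall x, exists a, (a <= j)%nat /\ U a x) ->
  exists a x y, (a <= j)%nat /\ s_chain dist (U a) s x y /\
    (IZR (scale i * (Z.of_nat m - 2)) <= dist x y)%R.
Proof.
  intros Hm Hs Hcov. apply NNPP. intros Hno.
  (* The first disjunct secures the condition on the lower face, whichever sets cover it. *)
  pose (P a x := x a = O \/ exists u, in_box u /\
    (forall b, (b <= j)%nat -> (x b <= u b + 1)%nat /\ (u b <= x b + 1)%nat) /\
    exists w, in_box w /\ (w a <= 1)%nat /\ s_chain dist (U a) s (box_pt u) (box_pt w)).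
  destruct (DiscretePoincareMiranda.discrete_poincare_miranda_nat (S j) m P)
    as [x [Hx Hnc]].
  - intros a x _ H. left. exact H.
  (* Here [u a >= m - 1] and [w a <= 1], so the chain from [u] to [w] is one of those excluded by
     [Hno]. *)
  - intros a x Ha Hxa [H|(u & Hu & Hxu & w & Hw & Hw1 & Hc)]; [lia|].
    apply Hno. exists a, (box_pt u), (box_pt w). split; [lia|]. split; [exact Hc|].
    eapply Rle_trans; [|apply (box_dist_ge u w a); auto; lia]. apply IZR_le.
    specialize (Hxu a ltac:(lia)). pose proof (scale_pos i). nia.
  - assert (Hbx : in_box x) by (intros a Ha; specialize (Hx a ltac:(lia)); lia).
    (* The lowest vertex [x] lies in some [U c]. Since [P c y] holds, the component of [x] meets the
       strip of points with coordinate [c] at most 1; as [z] is adjacent to [x], this gives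
       [P c z]. *)
    destruct (Hcov (box_pt x)) as [c [Hcj Hc]].
    destruct (Hnc c ltac:(lia)) as (y & z & Hy & Hz & HPy & HPz).
    assert (Hby : in_box y).
    { intros a Ha. specialize (Hx a ltac:(lia)). specialize (Hy a ltac:(lia)). lia. }
    apply HPz. right. exists x. split; [exact Hbx|].
    split; [intros b Hb; specialize (Hz b ltac:(lia)); lia|].
    destruct HPy as [H0|(u & Hu & Hyu & w & Hw & Hw1 & Hch)].
    + exists x. specialize (Hy c ltac:(lia)). split; [exact Hbx|]. split; [lia|].
      apply chain_refl. exact Hc.
    + exists w. split; [exact Hw|]. split; [exact Hw1|].
      (* [x] and [u] are both within one grid step of [y], hence at distance at most
         [2 * scale i < s]. *)
      apply chain_step with (box_pt u); [exact Hc| |exact Hch].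
      eapply Rle_lt_trans; [apply (box_dist_le x u 2); auto|exact Hs].
      intros b Hb. specialize (Hyu b Hb). specialize (Hy b ltac:(lia)). lia.
Qed.
End Box.

(** At scale [3 * scale i] a linear bound allows diameter [3 * C * scale i + k], but some component
    has diameter at least [scale i * (m - 2)], with [m] as large as desired. *)
Lemma dsum_not_asdimAN_le j :
  (forall b, exists i, (b <= i)%nat /\ (j < dim i)%nat) -> ~ asdimAN_le dist j.
Proof.
  intros Hlarge (C & k & HC & H).
  destruct (INR_unbounded (3 * C + Rabs k + 3)) as [b Hb].
  destruct (Hlarge b) as [i [Hbi Hji]].
  pose proof (Rabs_pos k). pose proof (Rle_abs k). pose proof (le_INR _ _ Hbi).
  assert (Hi : (3 < i)%nat) by (apply INR_lt; simpl; lra).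
  (* Half of the modulus, the largest box that fits. *)
  pose (m := (2 ^ (i - 1))%nat).
  assert (Hm : (i <= m)%nat).
  { unfold m. pose proof (Nat.pow_gt_lin_r 2 (i - 1) ltac:(lia)). lia. }
  assert (Hfit : 2 * Z.of_nat m <= modulus i).
  { unfold m, modulus. rewrite Nat2Z.inj_pow.
    rewrite <- Z.pow_succ_r by lia. apply Z.eq_le_incl. f_equal. lia. }
  pose proof (scale_pos i) as HK. apply IZR_lt in HK.
  assert (HK1 : (1 <= IZR (scale i))%R) by (apply IZR_le; pose proof (scale_pos i); lia).
  destruct (H (3 * IZR (scale i))%R ltac:(lra)) as [U [Hcov Hdiam]].
  destruct (box_long_chain i j m Hji Hfit U (3 * IZR (scale i))%R)
    as (a & x & y & Ha & Hc & Hd); [lia|rewrite mult_IZR; lra|exact Hcov|].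
  specialize (Hdiam a Ha x y Hc).
  rewrite mult_IZR, minus_IZR, <- INR_IZR_INZ in Hd.
  pose proof (le_INR _ _ Hm). nra.
Qed.
End DirectSum.

Local Open Scope R_scope.

Theorem theorem4p10 :
  forall n : natinf, n <> Fin 0 ->
    exists (G : Group) (d : G -> G -> R),
      locally_finite G /\ proper_left_invariant_metric G d /\ asdimAN_eq d n.
Proof.
  intros n _.
  (* For [Inf] each level has finite rank, but the ranks grow beyond every [j]. *)
  exists (dsum (fun i => match n with Fin p => p | Inf => i end)), (dist _).
  split; [apply dsum_locally_finite|]. split; [apply dist_proper_left_invariant|].
  destruct n as [p|]; simpl.
  - split; [apply dsum_asdimAN_le; auto|].
    intros j Hj. apply dsum_not_asdimAN_le. intros b. exists b. auto.
  - intros j. apply dsum_not_asdimAN_le. intros b. exists (S (max b j)). lia.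
Qed.
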